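(* The exponential generating function of the polynomials $P_n(x)$ is $$\sum_{k\ge 0}P_k(x)\frac{t^k}{k!}=\exp\left(\tfrac12\,\bigl(S\bigl(N(x)+t\,N'(x)\bigr)\bigr)^2-\tfrac{x^2}{2}\right),$$ i.e. for every $x\in\mathbb{R}$ this identity holds for all real $t$ sufficiently close to $0$.
   Context: $N:\mathbb{R}\to(0,1)$ is $N(x)=\frac{1}{\sqrt{2\pi}}\int_{-\infty}^{x}e^{-t^2/2}\,dt$, so $N'(x)=\frac{1}{\sqrt{2\pi}}e^{-x^2/2}$, and $S:(0,1)\to\mathbb{R}$ denotes the inverse of $N$. The polynomials $P_n(x)$, $n\ge 0$, are defined by $P_0(x)=1$ and $P_n(x)=P_{n-1}'(x)+n x P_{n-1}(x)$ for $n\ge 1$. *)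

(* Defs.v *)
(* MathComp-Analysis *)
From HB Require Import structures.
From mathcomp Require Import all_boot all_order all_algebra.
From mathcomp Require Import all_classical all_reals all_analysis.
Set Implicit Arguments.
Unset Strict Implicit.
Unset Printing Implicit Defensive.
Import Order.TTheory GRing.Theory Num.Theory.
Import numFieldNormedType.Exports.
Local Open Scope classical_set_scope.
Local Open Scope ring_scope.

Definition Ncdf {R : realType} (x : R) : R :=
  (Num.sqrt (2 * pi))^-1 *
  \int[lebesgue_measure]_(t in `]-oo, x]) expR (- t ^+ 2 / 2).

(* The inverse S of the bijection N = Ncdf from R onto (0, 1), extended to a
   total function by the value 0 outside (0, 1). *)
Definition Sinv {R : realType} (p : R) : R := xget 0 [set x | Ncdf x = p].

Fixpoint Ppoly (R : realType) (n : nat) : {poly R} :=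
  if n is m.+1 then (Ppoly R m)^`() + n%:R *: ('X * Ppoly R m) else 1.

(* Main.v *)
Require Import Defs.
From mathcomp Require Import all_boot all_order all_algebra.
From mathcomp Require Import all_classical all_reals all_analysis.
From mathcomp Require Import ring lra.
Import Order.TTheory GRing.Theory Num.Theory.
Import numFieldNormedType.Exports.
Local Open Scope classical_set_scope.
Local Open Scope ring_scope.

(* Put f(y) = exp(y^2/2 - x^2/2) and tau(y) = (N(y) - N(x)) / N'(x), so that
   tau' = 1/f, f' = y f, and tau(Y) = t means Y = S(N(x) + t N'(x)).  Taking y
   instead of t as the variable, d/dtau (P_k(y) f^(k+1)) = P_(k+1)(y) f^(k+2),
   so f has k-th derivative P_k(y) f^(k+1) with respect to tau, and at y = x
   this is P_k(x).  The Taylor remainder between x and Y tends to 0 for small t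
   because P_n has degree at most n and nonnegative coefficients, whence
   |P_n(y)| <= n! (1 + r)^n for |y| <= r and r >= 1. *)

(** * Growth of polynomials with nonnegative coefficients, in particular of P_n *)

Section NonnegativePolynomials.
Variable R : realType.
Implicit Type p : {poly R}.

Lemma normr_horner_le p (y r : R) :
  (forall i, 0 <= p`_i) -> `|y| <= r -> `|p.[y]| <= p.[r].
Proof.
move=> p0 yr; rewrite !horner_coef.
apply: (le_trans (ler_norm_sum _ _ _)); apply: ler_sum => i _.
rewrite normrM (ger0_norm (p0 i)) normrX ler_wpM2l// lerXn2r//.
by rewrite nnegrE (le_trans _ yr).
Qed.

(** Termwise, i c_i r^(i-1) <= n c_i r^i, because i <= n and r >= 1. *)
Lemma horner_deriv_le p n (r : R) : (forall i, 0 <= p`_i) -> 1 <= r ->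
  (size p <= n.+1)%N -> p^`().[r] <= n%:R * p.[r].
Proof.
move=> p0 r1 pn.
have pn' : (size p^`() <= n)%N.
  by rewrite (leq_trans (size_poly _ _))// -subn1 leq_subLR.
rewrite (horner_coef_wide _ pn') (horner_coef_wide _ pn) big_ord_recl mulrDr.
have r0 : 0 <= r by apply: le_trans r1.
rewrite -[leLHS]add0r lerD ?mulr_ge0 ?exprn_ge0// mulr_sumr.
apply: ler_sum => i _; rewrite coef_deriv -[_ *+ i.+1]mulr_natl -mulrA.
apply: ler_pM; rewrite ?mulr_ge0 ?exprn_ge0 ?ler_nat//=.
by rewrite exprS ler_wpM2l// ler_peMl ?exprn_ge0.
Qed.

Lemma size_Ppoly n : (size (Ppoly R n) <= n.+1)%N.
Proof.
elim: n => [|n IH] /=; first by rewrite size_poly1.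
rewrite (leq_trans (size_polyD _ _))// geq_max; apply/andP; split.
  by rewrite (leq_trans (size_poly _ _))// (leq_trans (leq_pred _))// leqW.
rewrite (leq_trans (size_scale_leq _ _))// (leq_trans (size_polyMleq _ _))//.
by rewrite size_polyX.
Qed.

Lemma Ppoly_ge0 n i : 0 <= (Ppoly R n)`_i.
Proof.
elim: n i => [|n IH] i /=; first by rewrite coef1 ler0n.
rewrite coefD coef_deriv coefZ coefXM addr_ge0 ?mulrn_wge0// mulr_ge0//.
by case: ifP.
Qed.

(** Nonnegative coefficients reduce the claim to y = r, where P_n'(r) <= n P_n(r) turns the
    recurrence into P_(n+1)(r) <= (n+1) (1 + r) P_n(r). *)
Lemma Ppoly_bound n (y r : R) : 1 <= r -> `|y| <= r ->
  `|(Ppoly R n).[y]| <= n`!%:R * (1 + r) ^+ n.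
Proof.
move=> r1 yr; apply: (le_trans (normr_horner_le _ _ _ (Ppoly_ge0 n) yr)).
elim: n => [|n IH] /=; first by rewrite hornerE fact0 mulr1.
have r0 : 0 <= r by apply: le_trans r1.
have P0 : 0 <= (Ppoly R n).[r].
  apply: (le_trans (normr_ge0 _) (normr_horner_le _ r r (Ppoly_ge0 n) _)).
  by rewrite ger0_norm.
rewrite hornerD hornerZ hornerM hornerX.
apply: (@le_trans _ _ (n.+1%:R * (1 + r) * (Ppoly R n).[r])).
  rewrite -mulrA mulrDl mul1r [leRHS]mulrDr lerD2r.
  apply: (le_trans (horner_deriv_le _ _ _ (Ppoly_ge0 n) r1 (size_Ppoly n))).
  by rewrite ler_wpM2r// ler_nat.
by rewrite factS natrM exprS mulrACA ler_wpM2l// mulr_ge0// addr_ge0.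
Qed.

End NonnegativePolynomials.

(** * The normal distribution function: derivative, monotonicity, inverse *)

Section NormalCdf.
Variable R : realType.
Notation mu := (@lebesgue_measure R).

Definition Npdf (x : R) : R := (Num.sqrt (2 * pi))^-1 * expR (- x ^+ 2 / 2).

Lemma Npdf_gt0 x : 0 < Npdf x.
Proof. by rewrite mulr_gt0 ?expR_gt0// invr_gt0 sqrtr_gt0 mulr_gt0 ?pi_gt0. Qed.

Lemma is_derive_Ncdf (x : R) : is_derive x 1 (@Ncdf R) (Npdf x).
Proof.
have E : (fun t : R => expR (- t ^+ 2 / 2)) = normal_fun 0 1.
  by apply/funext => t; rewrite /normal_fun subr0 expr1n.
have cf : continuous (fun t : R => expR (- t ^+ 2 / 2)).
  move=> t; apply: continuous_comp; last exact: continuous_expR.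
  by apply: cvgM; [apply: cvgN; exact: exprn_continuous|exact: cvg_cst].
(* The ray ends at x + 1 so that x is interior to it, as the fundamental theorem of calculus
   requires. Integrability comes from that of the standard normal density, a constant multiple of
   the integrand. *)
have intf : mu.-integrable `]-oo, (x + 1)]
    (EFin \o (fun t : R => expR (- t ^+ 2 / 2))).
  rewrite E; apply: (@integrableS _ _ _ _ setT) => //.
  have /(integrableZl measurableT (normal_peak 1)^-1) :=
    integrable_normal_pdf 0 (1 : R).
  apply: eq_integrable => // t _ /=.
  by rewrite normal_pdfE ?oner_eq0// -EFinM mulKf// gt_eqF ?normal_peak_gt0 ?oner_eq0.
have xx1 : x < x + 1 by rewrite ltrDl.
have [d dE] := continuous_FTC1 xx1 intf (ltNyr _) (cf x).
have H : is_derive x 1 (fun y => \int[mu]_(t in `]-oo, y]) expR (- t ^+ 2 / 2))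
   (expR (- x ^+ 2 / 2)).
  apply: DeriveDef; first exact: d.
  by rewrite -derive1E dE.
exact: is_deriveZ.
Qed.

Lemma Ncdf_lt : {homo @Ncdf R : x y / x < y}.
Proof.
move=> a b ab.
have [|c _ E] := MVT ab (fun x _ => is_derive_Ncdf x).
  apply: continuous_subspaceT => x.
  apply: differentiable_continuous; apply/derivable1_diffP.
  by have [] := is_derive_Ncdf x.
by rewrite -subr_gt0 E mulr_gt0 ?Npdf_gt0 ?subr_gt0.
Qed.

(** [xget] picks some preimage of [Ncdf x], which strict monotonicity forces to be x; the default 0
    cannot occur because x itself is a preimage. *)
Lemma NcdfK : cancel (@Ncdf R) Sinv.
Proof.
move=> x; rewrite /Sinv; case: xgetP => [y _ /= yx|/(_ x) /(_ erefl)//].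
apply/eqP; rewrite eq_le !leNgt.
by apply/andP; split; apply/negP => /Ncdf_lt; rewrite yx ltxx.
Qed.

End NormalCdf.

(** * Taylor expansion in the variable tau, and a mean value inequality *)

Section TaylorSum.
Variables (R : realType) (f tau : R -> R).
Hypothesis df : forall y : R, is_derive y 1 f (y * f y).
Hypothesis dtau : forall y : R, is_derive y 1 tau (f y)^-1.
Hypothesis f_neq0 : forall y, f y != 0.

(* The Taylor polynomial of f as a function of tau, expanded at tau(z) and
   evaluated at T; its derivative in z telescopes. *)
Lemma is_derive_taylor_sum (T : R) n (y : R) :
  is_derive y 1
    (fun z => \sum_(k < n.+1)
      (Ppoly R k).[z] * f z ^+ k.+1 * ((T - tau z) ^+ k / k`!%:R))
    ((Ppoly R n.+1).[y] * f y ^+ n.+1 * ((T - tau y) ^+ n / n`!%:R)).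
Proof.
elim: n => [|n IH].
  rewrite (_ : (fun z => _) = f); last first.
    apply/funext => z.
    by rewrite big_ord1 /= fact0 hornerC expr0 expr1 mul1r divr1 mulr1.
  apply: is_derive_eq; rewrite fact0 expr0 expr1 divr1 mulr1 /= derivC.
  by rewrite add0r scale1r mulr1 hornerX.
set H := (fun z => _) in IH.
set p := Ppoly R n.+1 in IH *.
pose v : R -> R := (n.+1)`!%:R^-1 *: (cst T - tau) ^+ n.+1.
rewrite (_ : (fun z => _) = H + (horner p : R -> R) * f ^+ n.+2 * v); last first.
  apply/funext => z; rewrite big_ord_recr.
  by rewrite {1}/H [RHS]/GRing.add /= /v !fctE [in RHS]/GRing.scale /= [_^-1 * _]mulrC.
have scaleE (a b : R) : a *: b = a * b by [].
(* Times P_(n+1) f^(n+2), this cancels the derivative given by [IH]. What is left is v (P_(n+1)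
   f^(n+2))' = v P_(n+2) f^(n+2), by f' = y f and the recurrence. *)
have dv : is_derive y 1 v (- ((T - tau y) ^+ n / n`!%:R / f y)).
  apply: is_derive_eq.
  rewrite factS natrM invfM !scaleE /= !fctE; field.
  by rewrite nat1r f_neq0 !pnatr_eq0 -lt0n fact_gt0.
have dpf := is_deriveM (is_derive_poly p y) (is_deriveX n.+2 (df y)).
apply: (is_derive_eq (is_deriveD IH (is_deriveM dpf dv))).
rewrite (_ : Ppoly R n.+2 = p^`() + n.+2%:R *: ('X * p))//.
rewrite hornerD hornerZ hornerM hornerX.
rewrite /v !fctE !scaleE.
rewrite !exprS /=; field.
by rewrite f_neq0 !pnatr_eq0 -!lt0n !fact_gt0.
Qed.

End TaylorSum.

(** The endpoints are unordered because Y lies on either side of x, according to the sign of t. *)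
Lemma le_norm_MVT (R : realType) (F dF : R -> R) (a b M : R) :
  (forall z : R, is_derive z 1 F (dF z)) ->
  (forall z, Num.min a b <= z <= Num.max a b -> `|dF z| <= M) ->
  `|F b - F a| <= M * `|b - a|.
Proof.
move=> dFP; wlog ab : a b / a <= b.
  move=> H dFM; have [/H|/ltW ba] := leP a b; first exact.
  rewrite distrC [X in M * X]distrC; apply: H => // z.
  by rewrite minC maxC; exact: dFM.
move=> dFM; have [|c + ->] := MVT_segment ab (fun z _ => dFP z).
  apply: derivable_within_continuous => z _.
  by have [] := dFP z.
by rewrite in_itv /= => cab; rewrite normrM ler_wpM2r// dFM// min_l// max_r.
Qed.

(** * Remainder estimate and convergence *)

Section ExponentialGeneratingFunction.
Variables (R : realType) (x : R).

Let f (y : R) := expR (y ^+ 2 / 2 - x ^+ 2 / 2).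
Let tau (y : R) := (Ncdf y - Ncdf x) / Npdf R x.

Let is_derive_f (y : R) : is_derive y 1 f (y * f y).
Proof.
have d2 : is_derive y 1 (fun z : R => z ^+ 2 / 2 - x ^+ 2 / 2) y.
  rewrite (_ : (fun z : R => _) = 2^-1 *: (id ^+ 2) - cst (x ^+ 2 / 2)); last first.
    by apply/funext => z; rewrite [RHS]/GRing.add /= !fctE /GRing.scale /= mulrC.
  apply: is_derive_eq.
  rewrite /GRing.scale /=; by field.
rewrite [y * _]mulrC.
exact: (@is_derive1_comp _ expR).
Qed.

Let is_derive_tau (y : R) : is_derive y 1 tau (f y)^-1.
Proof.
rewrite (_ : tau = (Npdf R x)^-1 *: (@Ncdf R - cst (Ncdf x))); last first.
  by apply/funext => z; rewrite /tau mulrC.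
have dN := is_derive_Ncdf R y.
apply: is_derive_eq; rewrite subr0 /GRing.scale /= /Npdf /f -expRN.
rewrite invfM mulrACA mulVf ?mul1r; last first.
  by rewrite invr_neq0// gt_eqF// sqrtr_gt0 mulr_gt0// pi_gt0.
by rewrite -expRN -expRD; congr expR; field.
Qed.

Let tau_lt : {homo tau : y z / y < z}.
Proof.
by move=> y z yz; rewrite /tau ltr_pM2r ?invr_gt0 ?Npdf_gt0// ltrD2r Ncdf_lt.
Qed.

Let tau_le : {homo tau : y z / y <= z}.
Proof. by move=> y z; rewrite le_eqVlt => /predU1P[->//|/tau_lt/ltW]. Qed.

Let tau0 : tau x = 0. Proof. by rewrite /tau subrr mul0r. Qed.

(** [r] bounds |y| on [x - 1, x + 1], [K] bounds f for |y| <= r, and [A] combines the growth of both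
    factors: |P_k(y) f(y)^k| <= k! A^k. *)
Let r : R := `|x| + 1.
Let K : R := expR (r ^+ 2 / 2).
Let A : R := (1 + r) * K.

Let r1 : 1 <= r. Proof. by rewrite lerDr. Qed.
Let r0 : 0 <= r. Proof. exact: le_trans r1. Qed.

Let A_gt0 : 0 < A. Proof. by rewrite mulr_gt0 ?expR_gt0// ltr_wpDr. Qed.

Let A_ge0 : 0 <= A. Proof. exact: ltW. Qed.

Let f_leK (y : R) : `|y| <= r -> f y <= K.
Proof.
move=> yr; rewrite ler_expR; apply: (@le_trans _ _ (y ^+ 2 / 2)).
  by rewrite gerBl divr_ge0 ?sqr_ge0.
by rewrite ler_pM2r// -real_normK ?num_real// lerXn2r.
Qed.

(* The factor 2 absorbs, through n + 1 <= 2^n, the n + 1 left over from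
   (n + 1)! / n!. *)
Let remainder_le (Y : R) n : x - 1 <= Y <= x + 1 ->
  `|f Y - series (fun k => (Ppoly R k).[x] * (tau Y ^+ k / k`!%:R)) n.+1|
    <= A * (2 * A * `|tau Y|) ^+ n.
Proof.
move=> Yx; set t := tau Y.
have f_neq0 y : f y != 0 by rewrite gt_eqF ?expR_gt0.
have dH := is_derive_taylor_sum R f tau is_derive_f is_derive_tau f_neq0 t n.
set H := (fun z => _) in dH.
(* At z = Y the factor T - tau(z) vanishes, so only the term k = 0 survives. *)
have -> : f Y = H Y.
  rewrite /H big_ord_recl big1 ?addr0 => [|i _].
    by rewrite /= hornerC fact0 expr0 divr1 mulr1 mul1r expr1.
  by rewrite subrr lift0 expr0n mul0r mulr0.
(* At z = x, tau(x) = 0 and f(x) = 1 leave the partial sum of the series. *)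
have -> : series (fun k => (Ppoly R k).[x] * (t ^+ k / k`!%:R)) n.+1 = H x.
  rewrite /series /= big_mkord; apply: eq_bigr => i _.
  by rewrite tau0 subr0 /f subrr expR0 expr1n mulr1.
have Yx1 : `|Y - x| <= 1 by rewrite ler_norml; lra.
pose M := A * (2 * A * `|t|) ^+ n.
have tA n' c : 0 <= c -> 0 <= A * (c * A * `|t|) ^+ n'.
  by move=> c0; exact: mulr_ge0 A_ge0 (exprn_ge0 _ (mulr_ge0 (mulr_ge0 c0 A_ge0) _)).
have M0 : 0 <= M by exact: tA.
apply: (@le_trans _ _ (M * `|Y - x|)); last by rewrite ler_piMr.
apply: (@le_norm_MVT _ _ _ _ _ _ dH) => z zxY.
have zr : `|z| <= r.
  have : `|z - x| <= 1 by move: zxY; rewrite ler_norml; case: (leP x Y); lra.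
  by move=> zx; rewrite /r -lerBlDl (le_trans _ zx)// lerB_dist.
(* Since tau increases and tau(x) = 0, tau(z) lies between 0 and t. *)
have tz : `|t - tau z| <= `|t|.
  move: zxY; have [xY|Yltx] := leP x Y => /andP[z1 z2].
    have := tau_le _ _ z1; have := tau_le _ _ z2; rewrite tau0 -/t => h1 h2.
    by rewrite !ger0_norm; lra.
  have := tau_le _ _ z1; have := tau_le _ _ z2; rewrite tau0 -/t => h1 h2.
  by rewrite !ler0_norm; lra.
rewrite !normrM normfV !normrX (ger0_norm (expR_ge0 _)) (ger0_norm (ler0n _ _)).
have n0 : 0 < n`!%:R :> R by rewrite ltr0n fact_gt0.
apply: (@le_trans _ _
  ((n.+1)`!%:R * (1 + r) ^+ n.+1 * K ^+ n.+1 * (`|t| ^+ n / n`!%:R))).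
  apply: ler_pM; rewrite ?mulr_ge0 ?exprn_ge0 ?invr_ge0 ?expR_ge0//.
    apply: ler_pM; rewrite ?exprn_ge0 ?expR_ge0//.
      exact: Ppoly_bound.
    by rewrite lerXn2r ?nnegrE ?expR_ge0 ?f_leK.
  by rewrite ler_pM2r ?invr_gt0// lerXn2r ?nnegrE.
rewrite (_ : _ * _ = n.+1%:R * (A * (A * `|t|) ^+ n)); last first.
  rewrite factS natrM /A !exprMn !exprS; field.
  by rewrite gt_eqF.
have -> : M = 2 ^+ n * (A * (A * `|t|) ^+ n).
  by rewrite /M -[2 * A * _]mulrA exprMn mulrCA.
rewrite ler_wpM2r//.
  by rewrite -[A * `|t|]mul1r mulrA tA.
by rewrite -natrX ler_nat ltn_expl.
Qed.

Lemma near_Ppoly_egf_remainder_le : \forall t \near (0 : R),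
  exists Y B z, [/\ Ncdf Y = Ncdf x + t * Npdf R x, `|z| < 1 & forall n,
    `|expR (Y ^+ 2 / 2 - x ^+ 2 / 2)
      - series (fun k => (Ppoly R k).[x] * (t ^+ k / k`!%:R)) n.+1|
    <= B * z ^+ n].
Proof.
have tauB : tau (x - 1) < 0 by rewrite -tau0 tau_lt// gtrBl.
have tauD : 0 < tau (x + 1) by rewrite -tau0 tau_lt// ltrDl.
have A2 : 0 < 2 * A by rewrite mulr_gt0.
have A2V : 0 < (2 * A)^-1 by rewrite invr_gt0.
have tauB' : 0 < - tau (x - 1) by rewrite oppr_gt0.
near=> t.
(* The first two bounds place t between tau(x - 1) and tau(x + 1), so that the intermediate value
   theorem yields Y; the third makes the ratio 2 A |t| less than 1. *)
have t1 : `|t| < - tau (x - 1) by near: t; exact: cvgr0_norm_lt.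
have t2 : `|t| < tau (x + 1) by near: t; exact: cvgr0_norm_lt.
have t3 : `|t| < (2 * A)^-1 by near: t; exact: cvgr0_norm_lt.
have [Y Yx tauY] : exists2 Y, Y \in `[x - 1, x + 1] & tau Y = t.
  apply: IVT; first lra.
    by apply: derivable_within_continuous => z _; have [] := is_derive_tau z.
  rewrite min_l ?max_r; [|lra..].
  by move: t1 t2; rewrite !ltr_norml; lra.
exists Y, A, (2 * A * `|t|); split.
- by rewrite -tauY /tau divfK ?gt_eqF ?Npdf_gt0// addrC subrK.
- rewrite normrM normr_id (gtr0_norm A2).
  by rewrite mulrC -ltr_pdivlMr// mul1r.
- move=> n; rewrite -tauY.
  by apply: remainder_le; move: Yx; rewrite in_itv.
Unshelve. all: by end_near. Qed.

End ExponentialGeneratingFunction.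

Theorem proposition10 (R : realType) (x : R) :
  \forall t \near (0 : R),
    series (fun k : nat => (Ppoly R k).[x] * (t ^+ k / k`!%:R)) n @[n --> \oo]
    --> expR ((Sinv (Ncdf x + t * derive1 Ncdf x)) ^+ 2 / 2 - x ^+ 2 / 2).
Proof.
apply: filterS (near_Ppoly_egf_remainder_le R x) => t [Y [B [z [NY z1 remY]]]].
rewrite derive1E (@derive_val _ _ _ _ _ _ _ (is_derive_Ncdf R x)) -NY NcdfK.
(* The remainder bound with exponent n concerns the partial sum of n + 1 terms, hence the shift. *)
rewrite -cvg_shiftS /=.
apply/cvgrPdist_lt => e e0.
have /cvgrPdist_lt/(_ e e0) := @cvg_geometric _ B _ z1.
apply: filterS => n; rewrite sub0r normrN; apply: le_lt_trans.
exact: le_trans (remY n) (ler_norm _).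
Qed.
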